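(* Let $r,q,n\ge1$ be integers and $a_0,a_1,\dots,a_r$ integers with $a_i\ge0$ for all $i\ge1$. Let $p=a_0+\sum_{i=1}^r a_i\binom{r}{i}$. Then \[\mathrm{rk}(M(n,r,q,\mathbf a))=\min\Big\{L_{\mathbf a}(E(K_n^{r}(q))),\ \min(q,\max(0,p))\binom{n}{r}\Big\}.\]
   Context: $K_n^r$ is the complete $r$-uniform hypergraph on $[n]$. $K_n^{r}(q)$ denotes the multihypergraph on $[n]$ with edge set $E=\{(e,i): e\in E(K_n^r),\ i\in[q]\}$. For $A\subseteq E$ let $\pi(A)=\{e: \exists i\ (e,i)\in A\}$. For an $r$-uniform hypergraph (edge set) $F$ and $m\ge1$, the $m$-shadow $\partial_m(F)$ is the set of $m$-element sets contained in some edge of $F$. Define $L_{\mathbf a}(A)=a_0+\sum_{i=1}^r a_i|\partial_i(\pi(A))|$ for $A\subseteq E$. The count matroid $M(n,r,q,\mathbf a)$ is the matroid on $E$ with rank function $\mathrm{rk}(A)=\max\{|B|: B\subseteq A,\ |C|\le L_{\mathbf a}(C)\text{ for every non-empty }C\subseteq B\}$ (this is a matroid); its rank is $\mathrm{rk}(M)=\mathrm{rk}(E)$.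
   Formalization: The right-hand side is replaced by its maximum with 0, because the displayed formula fails when L_a(E(K_n^r(q))) < 0 (e.g. r=q=n=1, a_0=-1, a_1=0: the rank is 0 but the formula gives -1); when L_a(E) ≥ 0 the formula is unchanged. *)

(* Defs.v *)
From mathcomp Require Import all_boot all_order all_algebra.

Set Implicit Arguments.
Unset Strict Implicit.
Unset Printing Implicit Defensive.

Import Order.TTheory GRing.Theory Num.Theory.

Local Open Scope ring_scope.

Definition complete_hypergraph (n r : nat) : {set {set 'I_n}} :=
  [set e : {set 'I_n} | #|e| == r].

Definition complete_multihypergraph (n r q : nat) : {set {set 'I_n} * 'I_q} :=
  [set x : {set 'I_n} * 'I_q | x.1 \in complete_hypergraph n r].

Definition edge_proj (n q : nat) (A : {set {set 'I_n} * 'I_q}) :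
    {set {set 'I_n}} :=
  [set x.1 | x in A].

Definition shadow (T : finType) (m : nat) (F : {set {set T}}) : {set {set T}} :=
  [set s : {set T} | (#|s| == m) && [exists e in F, s \subset e]].

(* Only the values a 0, ..., a r of the coefficient sequence are used. *)
Definition count_fun (n r q : nat) (a : nat -> int)
    (A : {set {set 'I_n} * 'I_q}) : int :=
  a 0%N + \sum_(1 <= i < r.+1) a i * #|shadow i (edge_proj A)|%:Z.

Definition count_indep (n r q : nat) (a : nat -> int)
    (B : {set {set 'I_n} * 'I_q}) : bool :=
  [forall C : {set {set 'I_n} * 'I_q},
     (C \subset B) && (C != set0) ==> (#|C|%:Z <= count_fun r a C)].

(* The set over which the maximum is taken always contains B = set0. *)
Definition count_rank (n r q : nat) (a : nat -> int)
    (A : {set {set 'I_n} * 'I_q}) : nat :=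
  \max_(B : {set {set 'I_n} * 'I_q} | (B \subset A) && count_indep r a B) #|B|.

Definition count_matroid_rank (n r q : nat) (a : nat -> int) : nat :=
  count_rank r a (complete_multihypergraph n r q).

(* Main.v *)
Require Import Defs.
From mathcomp Require Import all_boot all_order all_algebra.
From mathcomp Require Import zify ring.

(* Take a maximum independent set B. By submodularity of the count function L,
   intersecting tight sets (|C| = L(C)) have tight unions, so the maximal tight
   subsets of B are disjoint; every edge of K_n^r either has all its q copies in
   B or is spanned by one of them. It thus suffices that each nonempty F in K_n^r
   has density L(F) / |F| at least the smaller of the densities of a single edge
   and of K_n^r. This follows from a weak form of Kruskal-Katona: |shadow i F| is
   at least the linear interpolation, in |F|, between its values at a single edge
   and at K_n^r. *)

Set Implicit Arguments.
Unset Strict Implicit.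
Unset Printing Implicit Defensive.

Import Order.TTheory GRing.Theory Num.Theory.

Local Open Scope ring_scope.

(** * Binomial inequalities *)

Lemma mul_bin_bin (m r i : nat) : (i <= r)%N ->
  ('C(m, r) * 'C(r, i) = 'C(m, i) * 'C(m - i, r - i))%N.
Proof.
move=> le_ir; have [le_rm|lt_mr] := leqP r m; last first.
  rewrite bin_small // mul0n; have [le_im|lt_mi] := leqP i m.
    by rewrite [X in (_ * X)%N]bin_small ?muln0 //; lia.
  by rewrite bin_small.
have f_gt0 : (0 < i`! * (r - i)`! * (m - r)`!)%N by rewrite !muln_gt0 !fact_gt0.
apply/eqP; rewrite -(eqn_pmul2r f_gt0); apply/eqP.
have := bin_fact le_rm; have := bin_fact le_ir.
have := bin_fact (leq_trans le_ir le_rm).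
have le_ri_mi : (r - i <= m - i)%N by lia.
have := bin_fact le_ri_mi.
have -> : (m - i - (r - i) = m - r)%N by lia.
move=> E1 E2 E3 E4.
transitivity m`!; first by rewrite -E4 -E3; ring.
by rewrite -E2 -E1; ring.
Qed.

Lemma bin_gt1 (n k : nat) : (0 < k)%N -> (k < n)%N -> (1 < 'C(n, k))%N.
Proof.
case: n k => [|n] [|k] // _ lt_kn.
have := bin_gt0 n k; have := bin_gt0 n k.+1; rewrite binS; lia.
Qed.

(** After scaling by ['C(r, i)], [mul_bin_bin] exposes the common factor ['C(j, i) * 'C(m, i)]; what
    remains is ['C(j - i, r - i) <= 'C(m - i, r - i)]. *)
Lemma bin_ratio_le (j m r i : nat) : (i <= r)%N -> (j <= m)%N ->
  ('C(j, r) * 'C(m, i) <= 'C(m, r) * 'C(j, i))%N.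
Proof.
move=> le_ir le_jm.
have C_gt0 : (0 < 'C(r, i))%N by rewrite bin_gt0.
rewrite -(leq_pmul2r C_gt0) mulnAC [X in (_ <= X)%N]mulnAC !mul_bin_bin //.
rewrite mulnAC [X in (_ <= X)%N]mulnAC (mulnC 'C(m, i)) leq_mul2l.
by rewrite leq_bin2l ?orbT // leq_sub2r.
Qed.

(** The two differences are the sums of ['C(j, r)] and of ['C(j, i)] over [r < j < m];
    [bin_ratio_le] compares them term by term. *)
Lemma bin_chord_step (k m r i : nat) : (i <= r)%N -> (r < m)%N -> (m <= k)%N ->
  ('C(m, r.+1)%:Z - 1) * 'C(k, i)%:Z <=
    'C(k, r)%:Z * ('C(m, i.+1)%:Z - 'C(r.+1, i.+1)%:Z).
Proof.
move=> le_ir; elim: m => // m IHm; rewrite ltnS leq_eqVlt => /orP[/eqP<-|lt_rm].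
  by rewrite binn !subrr mul0r mulr0.
move=> lt_mk; have := IHm lt_rm (ltnW lt_mk).
have := bin_ratio_le le_ir (ltnW lt_mk).
rewrite (binS m r) (binS m i).
nia.
Qed.

(** The chord from [(1, 'C(r, i))] to [('C(m, r), 'C(m, i))] gets no steeper as [m] grows: by
    Pascal's rule the next segment has slope ['C(m, i.-1) / 'C(m, r.-1)], which [bin_chord_step]
    with [k = m] compares with the chord. *)
Lemma bin_chord (m r i : nat) : (0 < i)%N -> (i <= r)%N -> (r <= m)%N ->
  ('C(m, r)%:Z - 1) * ('C(m.+1, i)%:Z - 'C(r, i)%:Z) <=
  ('C(m.+1, r)%:Z - 1) * ('C(m, i)%:Z - 'C(r, i)%:Z).
Proof.
case: i => // i _; case: r => // r; rewrite ltnS => le_ir lt_rm.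
have := bin_chord_step le_ir lt_rm (leqnn m); rewrite (binS m r) (binS m i).
nia.
Qed.

(** Averaging step of [shadow_chord], for [t] edges on [n] vertices with [i]-shadow of size [S].
    Here [N], [M], [c] stand for ['C(n, r)], ['C(n, i)], ['C(r, i)], and [P], [A], [B] for the same
    with all arguments lowered by one; the last hypothesis is the sum of the inequalities for the
    links. *)
Lemma link_chord_arith (N P M c A B n r i t S : int) :
  r * N = n * P -> i * M = n * A -> i * c = r * B ->
  A <= B * P -> r <= n -> 0 < i -> 1 < P -> t <= N -> 1 <= N ->
  (r * t - n) * (A - B) <= (P - 1) * (i * S - n * B) ->
  (t - 1) * (M - c) <= (N - 1) * (S - c).
Proof.
move=> eN eM ec AB le_rn i_gt0 P_gt1 tN N_ge1 H.
have iP_gt0 : 0 < i * (P - 1) by rewrite mulr_gt0 ?subr_gt0.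
rewrite -(ler_pM2l iP_gt0).
have -> : i * (P - 1) * ((t - 1) * (M - c)) = (t - 1) * (i * M - i * c) * (P - 1).
  by ring.
have -> : i * (P - 1) * ((N - 1) * (S - c)) =
    (N - 1) * ((P - 1) * (i * S - n * B) + (P - 1) * (n * B - i * c)) by ring.
rewrite eM ec.
apply: (@le_trans _ _ ((N - 1) * ((r * t - n) * (A - B) + (P - 1) * (n * B - r * B)))).
  (* The difference is a product of nonnegative factors plus a multiple of [r * N - n * P = 0]. *)
  rewrite -subr_ge0.
  have -> : (N - 1) * ((r * t - n) * (A - B) + (P - 1) * (n * B - r * B)) -
      (t - 1) * (n * A - r * B) * (P - 1) =
      (N - t) * ((n - r) * (B * P - A)) + (t - 1) * (A - B) * (r * N - n * P).
    by ring.
  by rewrite eN subrr mulr0 addr0 !mulr_ge0 ?subr_ge0.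
by rewrite ler_wpM2l ?subr_ge0 // lerD2r.
Qed.

(** * Shadows, links and the weak Kruskal-Katona inequality *)

Section Shadow.
Variable T : finType.
Implicit Types (F G : {set {set T}}) (V e s : {set T}).

Lemma shadowP i F s :
  reflect (#|s| = i /\ exists2 e, e \in F & s \subset e) (s \in shadow i F).
Proof.
rewrite inE; apply: (iffP andP) => [[/eqP-> /existsP[e /andP[]]]|[-> [e Fe se]]].
  by split=> //; exists e.
by split=> //; apply/existsP; exists e; rewrite Fe.
Qed.

Lemma shadowS i F G : F \subset G -> shadow i F \subset shadow i G.
Proof.
move=> /subsetP sFG; apply/subsetP=> s /shadowP[si [e Fe se]].
by apply/shadowP; split=> //; exists e => //; apply: sFG.
Qed.

Lemma shadowU i F G : shadow i (F :|: G) = shadow i F :|: shadow i G.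
Proof.
apply/eqP; rewrite eqEsubset andbC subUset !shadowS ?subsetUl ?subsetUr //=.
apply/subsetP=> s /shadowP[si [e]] /setUP[] Fe se; apply/setUP.
  by left; apply/shadowP; split=> //; exists e.
by right; apply/shadowP; split=> //; exists e.
Qed.

(** Shadows commute with unions, while the shadow of an intersection lies in both shadows. *)
Lemma shadow_submod i F G :
  (#|shadow i (F :|: G)| + #|shadow i (F :&: G)| <=
   #|shadow i F| + #|shadow i G|)%N.
Proof.
rewrite -(cardsUI (shadow i F)) shadowU leq_add2l subset_leq_card // subsetI.
by rewrite !shadowS ?subsetIl ?subsetIr.
Qed.

Lemma card_shadow1 i e : #|shadow i [set e]| = 'C(#|e|, i).
Proof.
rewrite -cards_draws; apply: eq_card => s; rewrite [RHS]inE.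
apply/shadowP/andP => [[/eqP si [f /set1P-> ->]] //|[se /eqP si]].
by split=> //; exists e; rewrite ?set11.
Qed.

Lemma card_shadow_le i F : (#|shadow i F| <= 'C(#|T|, i))%N.
Proof.
rewrite -card_draws subset_leq_card //.
by apply/subsetP=> s; rewrite !inE => /andP[].
Qed.

(** Double counting of incident pairs; it serves both for a hypergraph and for its shadow. *)
Lemma sum_card_incident V F (k : nat) :
  (forall e, e \in F -> e \subset V /\ #|e| = k) ->
  (\sum_(v in V) #|[set e in F | v \in e]| = k * #|F|)%N.
Proof.
move=> FV; under eq_bigr => v _ do rewrite -sum1_card.
transitivity (\sum_(v in V) \sum_(e in F) (v \in e : nat))%N.
  apply: eq_bigr => v _; under eq_bigl => e do rewrite inE.
  by rewrite -big_mkcondr /= ?big_mkcondr.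
rewrite exchange_big mulnC -sum_nat_const; apply: eq_bigr => e Fe.
have [/setIidPl eV <-] := FV e Fe.
rewrite -{2}eV -sum1_card [RHS](eq_bigl (fun v => (v \in V) && (v \in e))).
  by rewrite [RHS]big_mkcondr.
by move=> v; rewrite inE andbC.
Qed.

Definition link (v : T) F : {set {set T}} :=
  [set e :\ v | e in [set e in F | v \in e]].

Lemma card_link v F : #|link v F| = #|[set e in F | v \in e]|.
Proof.
apply: card_in_imset => e f; rewrite !inE => /andP[_ ve] /andP[_ vf] eq_ef.
by rewrite -(setD1K ve) eq_ef setD1K.
Qed.

(** Sets in the shadow of the link avoid [v], so adding [v] to them is injective. *)
Lemma card_shadow_link i v F :
  (#|shadow i (link v F)| <= #|[set s in shadow i.+1 F | v \in s]|)%N.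
Proof.
have nv s : s \in shadow i (link v F) -> v \notin s.
  case/shadowP=> _ [_ /imsetP[e _ ->] /subsetP se]; apply/negP => /se.
  by rewrite !inE eqxx.
rewrite -(@card_in_imset _ _ (fun s => v |: s)); last first.
  move=> s t /nv ns /nv nt eq_st.
  by rewrite -(setU1K ns) eq_st setU1K.
apply: subset_leq_card; apply/subsetP=> _ /imsetP[s sh ->].
have := nv s sh; case/shadowP: sh => si [_ /imsetP[e eF ->] se] vs.
move: eF; rewrite inE => /andP[Fe ve].
rewrite inE setU11 andbT; apply/shadowP; split; first by rewrite cardsU1 vs si.
by exists e; rewrite // subUset sub1set ve (subset_trans se) ?subD1set.
Qed.

(* Induction on #|V|: if F covers V, average the inequality over the links of the
   vertices; otherwise delete an uncovered vertex, the chord for #|V| - 1 lying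
   above the one for #|V|. *)
Lemma shadow_chord (r i : nat) V F :
  (i <= r)%N -> F != set0 -> (forall e, e \in F -> e \subset V /\ #|e| = r) ->
  (#|F|%:Z - 1) * ('C(#|V|, i)%:Z - 'C(r, i)%:Z) <=
  ('C(#|V|, r)%:Z - 1) * (#|shadow i F|%:Z - 'C(r, i)%:Z).
Proof.
move nE : #|V| => n; elim: n => [|n IHn] in V nE r i F *.
all: move=> le_ir F0 FV; have [e0 Fe0] := set0Pn _ F0.
all: have [e0V e0r] := FV e0 Fe0.
all: have le_rn : (r <= #|V|)%N by rewrite -e0r subset_leq_card.
all: have tN : (#|F| <= 'C(#|V|, r))%N.
  1,3: rewrite -cards_draws subset_leq_card //; apply/subsetP=> e /FV[eV er].
  1,2: by rewrite inE eV er eqxx.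
all: have Sc : ('C(r, i) <= #|shadow i F|)%N
  by rewrite -e0r -card_shadow1 subset_leq_card // shadowS // sub1set.
all: have t0 : (0 < #|F|)%N by rewrite card_gt0.
all: rewrite nE in le_rn tN.
  move: le_rn le_ir tN; rewrite leqn0 => /eqP->; rewrite leqn0 => /eqP->.
  by rewrite !bin0; nia.
have [i0|i_gt0] := posnP i; first by move: Sc; rewrite i0 !bin0; nia.
(* For [i = r] the shadow contains [F] itself. *)
have [eq_ir|ne_ir] := eqVneq i r.
  rewrite eq_ir binn in Sc *.
  have : (#|F| <= #|shadow r F|)%N.
    apply: subset_leq_card; apply/subsetP=> e Fe; apply/shadowP.
    by have [_ er] := FV e Fe; split=> //; exists e.
  nia.
have lt_ir : (i < r)%N by rewrite ltn_neqAle ne_ir.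
move: le_rn; rewrite leq_eqVlt => /orP[/eqP eq_rn|].
  by rewrite -eq_rn binn in tN *; rewrite subrr mulr0 mul0r.
rewrite ltnS => le_rn.
have [/existsP[v /andP[Vv /forallP nvF]]|] :=
  boolP [exists v, (v \in V) && [forall e, (e \in F) ==> (v \notin e)]].
  have nV : #|V :\ v| = n by have := cardsD1 v V; rewrite Vv; lia.
  have FV' e : e \in F -> e \subset V :\ v /\ #|e| = r.
    move=> Fe; have [eV er] := FV e Fe; split=> //.
    by rewrite subsetD1 eV; apply: (implyP (nvF e)).
  have := IHn _ nV r i F le_ir F0 FV'.
  have := bin_chord i_gt0 le_ir le_rn.
  have tN1 : (#|F| <= 'C(n, r))%N.
    rewrite -nV -cards_draws subset_leq_card //; apply/subsetP=> e /FV'[eV er].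
    by rewrite inE eV er eqxx.
  have NN1 : ('C(n, r) <= 'C(n.+1, r))%N by rewrite leq_bin2l.
  set N := 'C(n.+1, r) in NN1 *; set N1 := 'C(n, r) in tN1 NN1 *.
  move=> H1 H2.
  (* If [N1 <= 1], then [F] is a single edge and the left side vanishes; otherwise [H1] and [H2]
     chain after scaling by [N1 - 1]. *)
  have [N1_le1|N1_gt1] := leqP N1 1; first by nia.
  have N1_gt0 : 0 < N1%:Z - 1 by lia.
  rewrite -(ler_pM2l N1_gt0).
  have t1 : 0 <= #|F|%:Z - 1 by lia.
  have Nm : 0 <= N%:Z - 1 by lia.
  have := ler_wpM2l t1 H1; have := ler_wpM2l Nm H2.
  lia.
rewrite negb_exists => /forallP cov.
have link0 v : v \in V -> link v F != set0.
  move=> Vv; have := cov v; rewrite Vv /= negb_forall => /existsP[e].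
  rewrite negb_imply negbK => /andP[Fe ve].
  by apply/set0Pn; exists (e :\ v); apply/imsetP; exists e; rewrite // inE Fe.
case: i i_gt0 lt_ir {ne_ir} Sc le_ir => // i _ lt_ir Sc le_ir.
case: r le_ir lt_ir FV e0r tN Sc le_rn => // r le_ir lt_ir FV e0r tN Sc le_rn.
have IH v : v \in V ->
    (#|link v F|%:Z - 1) * ('C(n, i)%:Z - 'C(r, i)%:Z) <=
    ('C(n, r)%:Z - 1) * (#|shadow i (link v F)|%:Z - 'C(r, i)%:Z).
  move=> Vv; apply: (IHn (V :\ v)) => //; first by have := cardsD1 v V; rewrite Vv; lia.
    exact: link0.
  move=> f /imsetP[e]; rewrite inE => /andP[Fe ve] ->.
  have [eV er] := FV e Fe; split; first exact: setSD.
  by have := cardsD1 v e; rewrite ve; lia.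
have sumF := sum_card_incident FV.
(* Each set in the shadow of [F] is counted at most once for each of its [i.+1] vertices. *)
have sumS : (\sum_(v in V) #|shadow i (link v F)| <= i.+1 * #|shadow i.+1 F|)%N.
  rewrite -(@sum_card_incident V); last first.
    move=> s /shadowP[si [e Fe se]]; split=> //.
    by have [eV _] := FV e Fe; apply: subset_trans eV.
  by apply: leq_sum => v _; apply: card_shadow_link.
have := ler_sum (index_enum T) IH.
rewrite -mulr_suml -mulr_sumr !big_split /= !sumr_const nE.
rewrite -!(big_morph Posz PoszD (erefl _)).
under eq_bigr => v _ do rewrite card_link.
rewrite sumF.
have eN := mul_bin_diag n.+1 r; have eM := mul_bin_diag n.+1 i.
have ec := mul_bin_diag r.+1 i; rewrite /= in eN eM ec.
have AB : ('C(n, i) <= 'C(r, i) * 'C(n, r))%N.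
  by rewrite mulnC mul_bin_bin // leq_pmulr // bin_gt0 leq_sub2r // ltnW.
have P_gt1 : (1 < 'C(n, r))%N by apply: bin_gt1 => //; lia.
move: {IH IHn cov link0}sumS; set Sg := (\sum_(_ in V) _)%N => sumS sumIH.
have eN' : r.+1%:Z * 'C(n.+1, r.+1)%:Z = n.+1%:Z * 'C(n, r)%:Z by rewrite -!PoszM eN.
have eM' : i.+1%:Z * 'C(n.+1, i.+1)%:Z = n.+1%:Z * 'C(n, i)%:Z by rewrite -!PoszM eM.
have ec' : i.+1%:Z * 'C(r.+1, i.+1)%:Z = r.+1%:Z * 'C(r, i)%:Z by rewrite -!PoszM ec.
have AB' : 'C(n, i)%:Z <= 'C(r, i)%:Z * 'C(n, r)%:Z by rewrite -PoszM lez_nat.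
apply: (link_chord_arith eN' eM' ec' AB') => //.
  exact: ltnW.
  by rewrite lez_nat bin_gt0 ltnW.
have mulrnZ (x : int) m : x *+ m = m%:Z * x by rewrite -mulr_natl natz.
move: sumIH; rewrite !mulrnZ !mulrN mulr1 PoszM => /le_trans; apply.
have P_ge0 : 0 <= 'C(n, r)%:Z - 1 by rewrite subr_ge0 lez_nat ltnW.
by rewrite ler_wpM2l // lerD2r -PoszM lez_nat.
Qed.

End Shadow.

(** * The count function on simple hypergraphs *)

Section CountFunction.
Variables (r : nat) (a : nat -> int).
Hypothesis a_ge0 : forall i : nat, (1 <= i <= r)%N -> 0 <= a i.

Definition hyper_count (T : finType) (F : {set {set T}}) : int :=
  a 0%N + \sum_(1 <= i < r.+1) a i * #|shadow i F|%:Z.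

Let p : int := a 0%N + \sum_(1 <= i < r.+1) a i * 'C(r, i)%:Z.

Lemma hyper_countS (T : finType) (F G : {set {set T}}) :
  F \subset G -> hyper_count F <= hyper_count G.
Proof.
move=> sFG; rewrite lerD2l ler_sum_nat // => i /a_ge0 ai.
by rewrite ler_wpM2l // lez_nat subset_leq_card // shadowS.
Qed.

Lemma hyper_count_submod (T : finType) (F G : {set {set T}}) :
  hyper_count (F :|: G) + hyper_count (F :&: G) <= hyper_count F + hyper_count G.
Proof.
rewrite /hyper_count [X in X <= _]addrACA [X in _ <= X]addrACA lerD2l.
rewrite -!big_split /= ler_sum_nat // => i /a_ge0 ai; rewrite -!mulrDr.
by rewrite ler_wpM2l // -!PoszD lez_nat shadow_submod.
Qed.

Lemma hyper_count1 (T : finType) (e : {set T}) :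
  #|e| = r -> hyper_count [set e] = p.
Proof.
by move=> er; congr (_ + _); apply: eq_bigr => i _; rewrite card_shadow1 er.
Qed.

(** This is the sum of the inequalities [shadow_chord] with weights [a i]. *)
Lemma hyper_count_chord (n : nat) (F : {set {set 'I_n}}) :
  F != set0 -> F \subset complete_hypergraph n r ->
  ('C(n, r)%:Z - #|F|%:Z) * p + (#|F|%:Z - 1) *
    (a 0%N + \sum_(1 <= i < r.+1) a i * 'C(n, i)%:Z) <=
  ('C(n, r)%:Z - 1) * hyper_count F.
Proof.
move=> F0 /subsetP FK.
have FV e : e \in F -> e \subset [set: 'I_n] /\ #|e| = r.
  by move=> /FK; rewrite inE subsetT => /eqP.
rewrite /p /hyper_count !mulrDr !mulr_sumr addrACA -mulrDl.
(* The coefficients of [a 0] agree on both sides, so it cancels. *)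
rewrite (_ : _ - _ + _ = 'C(n, r)%:Z - 1); last by ring.
rewrite lerD2l -big_split ler_sum_nat //= => i ir.
have le_ir : (i <= r)%N by case/andP: ir.
have := ler_wpM2l (a_ge0 ir) (shadow_chord le_ir F0 FV).
rewrite cardsT card_ord -subr_ge0 => chord; rewrite -subr_ge0.
by congr (0 <= _): chord; ring.
Qed.

(** Both the chord bound and [mu * #|F|] are affine in [#|F|], so they need comparing only at 1 and
    at ['C(n, r)]; the two bounds on [mu] do this. *)
Lemma hyper_count_density (n : nat) (F : {set {set 'I_n}}) (mu : int) :
  F != set0 -> F \subset complete_hypergraph n r ->
  mu <= hyper_count (complete_hypergraph n r) -> mu <= p * 'C(n, r)%:Z ->
  mu * #|F|%:Z <= 'C(n, r)%:Z * hyper_count F.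
Proof.
move=> F0 FK muK mup; have chord := hyper_count_chord F0 FK.
have cardK : #|complete_hypergraph n r| = 'C(n, r) by rewrite card_draws card_ord.
have t_gt0 : (0 < #|F|)%N by rewrite card_gt0.
have tN : (#|F| <= 'C(n, r))%N by rewrite -cardK subset_leq_card.
have muM : mu <= a 0%N + \sum_(1 <= i < r.+1) a i * 'C(n, i)%:Z.
  apply: le_trans muK _; rewrite lerD2l ler_sum_nat // => i /a_ge0 ai.
  rewrite ler_wpM2l // lez_nat.
  by have := card_shadow_le i (complete_hypergraph n r); rewrite card_ord.
(* For ['C(n, r) = 1] the chord degenerates to a point, and [F] is a single edge with count [p]. *)
have [N1|N_gt1] := leqP 'C(n, r) 1.
  have t1 : #|F| = 1%N by lia.
  have N1' : 'C(n, r) = 1%N by lia.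
  move/eqP/cards1P: t1 => [e Fe]; rewrite Fe cards1 N1' mulr1 mul1r.
  rewrite hyper_count1; first by rewrite N1' mulr1 in mup.
  by move: FK; rewrite Fe sub1set inE => /eqP.
move: muM chord; set M := (_ + \sum_(1 <= i < r.+1) _ * 'C(n, i)%:Z) => muM chord.
have Nm_gt0 : 0 < 'C(n, r)%:Z - 1 by lia.
rewrite -(ler_pM2l Nm_gt0).
have N_ge0 : 0 <= 'C(n, r)%:Z by [].
have t_ge0 : 0 <= ('C(n, r)%:Z - #|F|%:Z) by lia.
have t1_ge0 : 0 <= 'C(n, r)%:Z * (#|F|%:Z - 1) by rewrite mulr_ge0 // subr_ge0.
(* The value [#|F|] is split into its weights on the endpoints 1 and ['C(n, r)]. *)
have -> : ('C(n, r)%:Z - 1) * (mu * #|F|%:Z) =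
    ('C(n, r)%:Z - #|F|%:Z) * mu + 'C(n, r)%:Z * (#|F|%:Z - 1) * mu by ring.
apply: le_trans (lerD (ler_wpM2l t_ge0 mup) (ler_wpM2l t1_ge0 muM)) _.
by have := ler_wpM2l N_ge0 chord; congr (_ <= _); ring.
Qed.

End CountFunction.

(** * The count matroid and upper bounds on independent sets *)

Section CountMatroid.
Variables (n r q : nat) (a : nat -> int).
Hypothesis a_ge0 : forall i : nat, (1 <= i <= r)%N -> 0 <= a i.

Local Notation E := (complete_multihypergraph n r q).
Local Notation K := (complete_hypergraph n r).
Local Notation edges := ({set {set 'I_n} * 'I_q}).
Implicit Types (A B C D : edges) (e : {set 'I_n}).

Let p : int := a 0%N + \sum_(1 <= i < r.+1) a i * 'C(r, i)%:Z.

Lemma edge_projS A B : A \subset B -> edge_proj A \subset edge_proj B.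
Proof. exact: imsetS. Qed.

Lemma edge_proj_sub B : B \subset E -> edge_proj B \subset K.
Proof.
by move/subsetP=> BE; apply/subsetP=> _ /imsetP[x /BE + ->]; rewrite inE.
Qed.

Lemma edge_proj1 (x : {set 'I_n} * 'I_q) : edge_proj [set x] = [set x.1].
Proof. exact: imset_set1. Qed.

Lemma edge_proj_eq0 A : (edge_proj A == set0) = (A == set0).
Proof. exact: imset_eq0. Qed.

Lemma count_funE A : count_fun r a A = hyper_count r a (edge_proj A).
Proof. by []. Qed.

Lemma count_funS A B : A \subset B -> count_fun r a A <= count_fun r a B.
Proof. by move=> sAB; apply: hyper_countS => //; apply: edge_projS. Qed.

Lemma count_fun_submod A B :
  count_fun r a (A :|: B) + count_fun r a (A :&: B) <=
  count_fun r a A + count_fun r a B.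
Proof.
apply: le_trans (hyper_count_submod a_ge0 (edge_proj A) (edge_proj B)).
rewrite lerD // count_funE; first by rewrite /edge_proj imsetU.
by apply: hyper_countS => //; rewrite subsetI !edge_projS ?subsetIl ?subsetIr.
Qed.

Lemma count_indepP B :
  reflect (forall C, C \subset B -> C != set0 -> #|C|%:Z <= count_fun r a C)
          (count_indep r a B).
Proof.
apply: (iffP forallP) => [indB C CB C0|indB C].
  by apply: (implyP (indB C)); rewrite CB.
by apply/implyP=> /andP[]; apply: indB.
Qed.

(** The maximum with 0 covers the empty set, which is independent even if the count of [E] is
    negative. *)
Lemma card_indep_le_count B : B \subset E -> count_indep r a B ->
  #|B|%:Z <= Num.max 0 (count_fun r a E).
Proof.
move=> BE /count_indepP indB; have [->|B0] := eqVneq B set0.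
  by rewrite cards0 le_max lexx.
by apply: le_trans (indB B (subxx B) B0) _; rewrite le_max count_funS ?orbT.
Qed.

(** The copies in [B] of one edge number at most [q]; if there are any, they form a nonempty subset
    of [B] with count [p], so they number at most [p]. *)
Lemma card_indep_le_parallel B : B \subset E -> count_indep r a B ->
  #|B|%:Z <= Num.min q%:Z (Num.max 0 p) * 'C(n, r)%:Z.
Proof.
move=> /subsetP BE /count_indepP indB; rewrite -sum1_card.
rewrite (partition_big fst (mem K)) => [|x /BE]; last by rewrite inE.
rewrite (big_morph Posz PoszD (erefl _)).
have -> : 'C(n, r) = #|K| by rewrite card_draws card_ord.
rewrite mulrC -[#|K|%:Z]natz mulr_natl -sumr_const; apply: ler_sum => e Ke.
set D := [set x in B | x.1 == e].
have -> : (\sum_(x in B | x.1 == e) 1 = #|D|)%N.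
  by rewrite -sum1_card; apply: eq_bigl => x; rewrite inE.
rewrite le_min lez_nat; apply/andP; split.
  rewrite -[q in (_ <= q)%N]card_ord -(@card_in_imset _ _ snd).
    exact: max_card.
  move=> [e1 i1] [e2 i2]; rewrite !inE /= => /andP[_ /eqP->] /andP[_ /eqP->].
  by move=> ->.
have [->|D0] := eqVneq D set0; first by rewrite cards0 le_max lexx.
have DB : D \subset B by apply/subsetP=> x; rewrite inE => /andP[].
apply: le_trans (indB D DB D0) _; rewrite le_max; apply/orP; right.
have er : #|e| = r by move: Ke; rewrite /= inE => /eqP.
rewrite /p -(hyper_count1 a er); apply: hyper_countS => //.
by apply/subsetP=> _ /imsetP[x + ->]; rewrite !inE => /andP[].
Qed.

(** * Tight sets and the size of a maximum independent set *)

Section Basis.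
Variable B : edges.
Hypothesis BE : B \subset E.
Hypothesis indB : count_indep r a B.

Definition tight C : bool :=
  [&& C \subset B, C != set0 & count_fun r a C == #|C|%:Z].

(** With [L] the count, submodularity gives [L(C :|: D) <= |C| + |D| - L(C :&: D)]. Independence
    gives [|C :&: D| <= L(C :&: D)] because the intersection is nonempty. *)
Lemma tightU C D : tight C -> tight D -> C :&: D != set0 -> tight (C :|: D).
Proof.
case/and3P=> CB C0 /eqP eC /and3P[DB D0 /eqP eD] CD0.
have CDB : C :|: D \subset B by rewrite subUset CB.
have CD0' : C :|: D != set0.
  by apply: contraNneq C0 => CD; rewrite -subset0 -CD subsetUl.
rewrite /tight CDB CD0' /= eq_le; have /count_indepP ind := indB.
rewrite (ind _ CDB CD0') andbT.
rewrite -(lerD2r (count_fun r a (C :&: D))).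
apply: le_trans (count_fun_submod C D) _; rewrite eC eD -PoszD -cardsUI PoszD.
by rewrite lerD2l ind // (subset_trans (subsetIl _ _)).
Qed.

Definition tight_parts : {set edges} := [set C | maxset tight C].

Lemma trivIset_tight_parts : trivIset tight_parts.
Proof.
apply/trivIsetP=> C D; rewrite !inE => /maxsetP[tC mC] /maxsetP[tD mD].
apply: contraNT; rewrite -setI_eq0 => CD0; have tCD := tightU tC tD CD0.
by rewrite -(mC _ tCD (subsetUl _ _)) -{2}(mD _ tCD (subsetUr _ _)).
Qed.

(* Shadows of weight 0 are ignored, so that span C consists of all the edges whose
   addition to C leaves the count unchanged. *)
Definition span C : {set {set 'I_n}} :=
  [set e in K | [forall i : 'I_r.+1, (0 < i)%N && (0 < a i) ==>
                   (shadow i [set e] \subset shadow i (edge_proj C))]].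

Lemma spanP C e :
  reflect (e \in K /\ forall i, (1 <= i <= r)%N -> 0 < a i ->
             shadow i [set e] \subset shadow i (edge_proj C))
          (e \in span C).
Proof.
apply: (iffP setIdP) => -[Ke H]; split=> //.
  move=> i /andP[i0 ir] ai.
  by have /implyP := forallP H (Ordinal (ir : (i < r.+1)%N)); apply; rewrite /= i0.
by apply/forallP=> i; apply/implyP=> /andP[i0 ai]; rewrite H // i0 -ltnS ltn_ord.
Qed.

Lemma spanS C D : C \subset D -> span C \subset span D.
Proof.
move=> CD; apply/subsetP=> e /spanP[Ke H]; apply/spanP; split=> // i ir ai.
by apply: subset_trans (H i ir ai) _; rewrite shadowS ?edge_projS.
Qed.

Lemma edge_proj_span C : C \subset E -> edge_proj C \subset span C.
Proof.
move=> CE; apply/subsetP=> e Ce; apply/spanP; split=> [|i _ _].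
  exact: (subsetP (edge_proj_sub CE)).
by rewrite shadowS // sub1set.
Qed.

Lemma hyper_count_span C : hyper_count r a (span C) <= count_fun r a C.
Proof.
rewrite lerD2l ler_sum_nat // => i ir.
have := a_ge0 ir; rewrite le_eqVlt => /predU1P[<-|ai]; first by rewrite !mul0r.
rewrite ler_pM2l // lez_nat subset_leq_card //.
apply/subsetP=> s /shadowP[si [e /spanP[_ /(_ i ir ai) /subsetP es] se]].
by apply: es; apply/shadowP; split=> //; exists e; rewrite ?set11.
Qed.

(** Adding [x] can only enlarge shadows, and growth of one of positive weight would strictly raise
    the count. *)
Lemma count_fun_eq_span C x : x \in E ->
  count_fun r a (x |: C) <= count_fun r a C -> x.1 \in span C.
Proof.
move=> Ex le_xC; apply/spanP; split=> [|i ir ai]; first by move: Ex; rewrite inE.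
have sC j : shadow j (edge_proj C) \subset shadow j (edge_proj (x |: C)).
  by rewrite shadowS ?edge_projS ?subsetUr.
suff <- : shadow i (edge_proj (x |: C)) = shadow i (edge_proj C).
  by rewrite shadowS // -edge_proj1 edge_projS ?subsetUl.
apply/esym/eqP; rewrite eqEcard sC leqNgt; apply/negP => lt_i.
move: le_xC; apply/negP; rewrite -ltNge /count_fun ltrD2l.
have ir' : i \in index_iota 1 r.+1 by rewrite mem_index_iota.
rewrite !(big_rem i ir') /= ltr_leD ?ltr_pM2l //.
rewrite big_seq [X in _ <= X]big_seq ler_sum // => j /mem_rem.
rewrite mem_index_iota => /a_ge0 aj.
by rewrite ler_wpM2l // lez_nat subset_leq_card.
Qed.

Hypothesis p_gt0 : 0 < p.
Hypothesis maxB : forall D, D \subset E -> count_indep r a D -> (#|D| <= #|B|)%N.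

(** By maximality [x |: B] contains a violating [D], and [x] is in [D]. For [C = D :\ x] this gives
    [|C| <= L(C) <= L(D) <= |C|], so [C] is tight and [x] does not raise its count. *)
Lemma span_tight_part x : x \in E -> x \notin B ->
  exists2 C, C \in tight_parts & x.1 \in span C.
Proof.
move=> Ex nBx; have /count_indepP ind := indB.
have : ~~ count_indep r a (x |: B).
  apply/negP => /maxB; rewrite subUset sub1set Ex BE cardsU1 nBx add1n ltnn.
  by move/(_ isT).
rewrite negb_forall => /existsP[D]; rewrite negb_imply -ltNge.
case/andP=> /andP[DB D0] ltD.
have Dx : x \in D.
  apply: contraTT ltD => nDx; rewrite -leNgt ind //.
  apply/subsetP=> y Dy; have := subsetP DB y Dy; rewrite !inE => /predU1P[yx|//].
  by rewrite -yx Dy in nDx.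
pose C := D :\ x; have DE : x |: C = D by rewrite setD1K.
have CB : C \subset B by rewrite subDset.
have cD : #|D| = #|C|.+1 by rewrite (cardsD1 x) Dx.
have LCD : count_fun r a C <= count_fun r a D by rewrite count_funS // subD1set.
(* A single edge has count [p >= 1], so it is no violation by itself. *)
have C0 : C != set0.
  apply: contraTneq ltD => C_0; rewrite -leNgt cD C_0 cards0 -DE C_0 setU0.
  rewrite count_funE edge_proj1 hyper_count1 //.
  by move: Ex; rewrite !inE => /eqP.
have LC := ind C CB C0.
have LD : count_fun r a D <= #|C|%:Z.
  by move: ltD; rewrite cD -addn1 PoszD ltzD1.
have tC : tight C by rewrite /tight CB C0 /= eq_le LC (le_trans LCD).
have [M mM CM] := maxset_exists tC.
exists M; first by rewrite inE.
apply: (subsetP (spanS CM)); apply: count_fun_eq_span => //.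
by rewrite DE (le_trans LD).
Qed.

(** Every edge of [K] claims a share [mu / 'C(n, r)] of [B]: an edge outside all spans is paid by
    its [q] copies, the edges of [span C] by the elements of [C]. *)
Lemma basis_size_ge (mu : int) : 0 <= mu ->
  mu <= hyper_count r a K -> mu <= p * 'C(n, r)%:Z -> mu <= q%:Z * 'C(n, r)%:Z ->
  (0 < 'C(n, r))%N -> mu <= #|B|%:Z.
Proof.
move=> mu_ge0 muK mup muq N_gt0.
have cardK : #|K| = 'C(n, r) by rewrite card_draws card_ord.
pose F0 := K :\: \bigcup_(C in tight_parts) span C.
have F0B : setX F0 [set: 'I_q] \subset B :\: cover tight_parts.
  apply/subsetP=> -[e j]; rewrite !inE /= andbT -/K => /andP[nspan Ke].
  have Ex : (e, j) \in E by rewrite !inE.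
  apply/andP; split; last first.
    apply: contraNT nspan => nB; have [C PC eC] := span_tight_part Ex nB.
    by apply/bigcupP; exists C.
  apply: contra nspan => /bigcupP[C PC Cx]; apply/bigcupP; exists C => //.
  have /maxsetP[/and3P[CB _ _] _] : maxset tight C by rewrite inE in PC.
  apply: (subsetP (edge_proj_span (subset_trans CB BE))).
  by apply/imsetP; exists (e, j).
have coverB : cover tight_parts \subset B.
  apply/bigcupsP=> C; rewrite inE => /maxsetP[/and3P[CB _ _] _] //.
have cB : (q * #|F0| + \sum_(C in tight_parts) #|C| <= #|B|)%N.
  rewrite (eqP trivIset_tight_parts) -(cardsID (cover tight_parts) B).
  rewrite (setIidPr coverB) addnC leq_add2l.
  by rewrite mulnC -[q in (_ * q)%N]card_ord -cardsT -cardsX subset_leq_card.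
(* Spans may overlap, so this is only a union bound. *)
have cN : ('C(n, r) <= #|F0| + \sum_(C in tight_parts) #|span C|)%N.
  rewrite -cardK -(cardsID (\bigcup_(C in tight_parts) span C) K) addnC leq_add2l.
  apply: leq_trans (subset_leq_card (subsetIr _ _)) _.
  elim/big_rec2: _ => [|C m U _ IH]; first by rewrite cards0.
  by apply: leq_trans (leq_card_setU _ _) _; rewrite leq_add2l.
(* The density bound is applied to [span C], whose count is at most that of [C], which is [#|C|] by
   tightness. *)
have part C : C \in tight_parts -> mu * #|span C|%:Z <= 'C(n, r)%:Z * #|C|%:Z.
  rewrite inE => /maxsetP[/and3P[CB C0 /eqP eC] _]; rewrite -eC.
  apply: le_trans (_ : _ <= 'C(n, r)%:Z * hyper_count r a (span C)) _.
    apply: hyper_count_density => //.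
      rewrite -edge_proj_eq0 in C0; apply: contraNneq C0 => sC.
      by rewrite -subset0 -sC edge_proj_span // (subset_trans CB).
    by apply/subsetP=> e /spanP[].
  by rewrite ler_wpM2l // hyper_count_span.
have N_gt0' : 0 < 'C(n, r)%:Z by [].
rewrite -(ler_pM2l N_gt0').
have /(ler_sum (index_enum _)) := part; rewrite -!mulr_sumr.
rewrite -!(big_morph Posz PoszD (erefl _)).
move: cB cN; set S1 := (\sum_(C in _) _)%N; set S2 := (\sum_(C in _) _)%N.
move=> cB cN H.
have cN' : mu * 'C(n, r)%:Z <= mu * (#|F0|%:Z + S2%:Z).
  by rewrite ler_wpM2l // -PoszD lez_nat.
have cB' : 'C(n, r)%:Z * (q%:Z * #|F0|%:Z + S1%:Z) <= 'C(n, r)%:Z * #|B|%:Z.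
  by rewrite ler_wpM2l // -PoszM -PoszD lez_nat.
have F0' : mu * #|F0|%:Z <= q%:Z * 'C(n, r)%:Z * #|F0|%:Z by rewrite ler_wpM2r.
rewrite mulrC; apply: le_trans cN' (le_trans _ cB'); rewrite !mulrDr lerD //.
by rewrite mulrA (mulrC _ q%:Z).
Qed.

End Basis.

End CountMatroid.

(** The outer [Num.max 0] matters when the count of the whole edge set is negative: then only the
    empty set is independent and the rank is 0. *)
Theorem theorem4p17 (r q n : nat) (a : nat -> int)
    (hr : (1 <= r)%N) (hq : (1 <= q)%N) (hn : (1 <= n)%N)
    (ha : forall i : nat, (1 <= i <= r)%N -> 0 <= a i) :
  let p : int := a 0%N + \sum_(1 <= i < r.+1) a i * 'C(r, i)%:Z in
  (count_matroid_rank n r q a)%:Z =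
  Num.max 0
    (Num.min (count_fun r a (complete_multihypergraph n r q))
             (Num.min q%:Z (Num.max 0 p) * 'C(n, r)%:Z)).
Proof.
move=> p; set E := complete_multihypergraph n r q.
pose ok (B : {set {set 'I_n} * 'I_q}) := (B \subset E) && count_indep r a B.
have ok0 : ok set0.
  rewrite /ok sub0set; apply/count_indepP => C; rewrite subset0 => /eqP->.
  by rewrite eqxx.
have [B okB rankE] : {B | ok B & count_matroid_rank n r q a = #|B|}.
  by apply: eq_bigmax_cond; apply/card_gt0P; exists set0.
have maxB (D : {set {set 'I_n} * 'I_q}) :
    D \subset E -> count_indep r a D -> (#|D| <= #|B|)%N.
  by move=> DE indD; rewrite -rankE; apply: leq_bigmax_cond; rewrite DE.
have /andP[BE indB] := okB.
rewrite rankE; apply/eqP; rewrite eq_le; apply/andP; split.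
  have := card_indep_le_count ha BE indB.
  have := card_indep_le_parallel ha BE indB.
  by rewrite -/p -/E; lia.
rewrite ge_max lez_nat leq0n /=.
set mu := Num.min _ _; have [mu_le0|mu_gt0] := leP mu 0.
  exact: le_trans mu_le0 _.
have mu1 : mu <= count_fun r a E by rewrite ge_min lexx.
have mu2 : mu <= Num.min q%:Z (Num.max 0 p) * 'C(n, r)%:Z.
  by rewrite ge_min lexx orbT.
(* A positive [mu] forces both ['C(n, r)] and [p] to be positive. *)
have N_gt0 : (0 < 'C(n, r))%N.
  by rewrite lt0n; apply/eqP => N0; rewrite N0 mulr0 in mu2; lia.
have p_gt0 : 0 < p.
  rewrite ltNge; apply/negP => p_le0; move: mu2.
  by rewrite (max_idPl p_le0) (min_idPr _) // mul0r; lia.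
rewrite (max_idPr (ltW p_gt0)) in mu2.
apply: (basis_size_ge ha BE indB p_gt0 maxB) => //.
- exact: ltW.
- by apply: le_trans mu1 _; apply: hyper_countS => //; apply: edge_proj_sub.
- by apply: le_trans mu2 _; rewrite ler_wpM2r // ge_min lexx orbT.
- by apply: le_trans mu2 _; rewrite ler_wpM2r // ge_min lexx.
Qed.
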